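(* For every integer $n\ge 2$, the $1$-extra connectivity of the $3$-ary $n$-cube satisfies $\kappa_1(Q_n^3)=4n-3$.
   Context: The $3$-ary $n$-cube $Q_n^3$ is the graph whose vertices are the strings $x_1x_2\cdots x_n$ with each $x_i\in\{0,1,2\}$, two vertices $x,y$ being adjacent iff their Lee distance is $1$, where the Lee distance is $D_L(x,y)=\sum_{i=1}^n |(x_i-y_i)\bmod 3|$ with $|a|=\min(a,3-a)$ for $a\in\{0,1,2\}$. Equivalently, $x,y$ are adjacent iff they differ in exactly one coordinate. For a graph $G$ and integer $h\ge 0$, a vertex set $S\subseteq V(G)$ is an $h$-extra vertex-cut if $G-S$ is disconnected and every component of $G-S$ has more than $h$ vertices; the $h$-extra connectivity $\kappa_h(G)$ is the minimum cardinality of an $h$-extra vertex-cut. *)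

(* Defs.v *)
From mathcomp Require Import all_boot all_order all_algebra.

Set Implicit Arguments.
Unset Strict Implicit.
Unset Printing Implicit Defensive.

(* A simple graph is a symmetric irreflexive adjacency relation e on T. *)
Section ExtraConnectivity.
Variables (T : finType) (e : rel T).

Definition del_vertices (S : {set T}) : rel T :=
  [rel x y | [&& x \notin S, y \notin S & e x y]].

Definition component (S : {set T}) (x : T) : {set T} :=
  [set y | connect (del_vertices S) x y].

(* Every x \notin S has component S x included in ~: S, so these are exactly
   the vertex sets of the connected components of G - S. *)
Definition components (S : {set T}) : {set {set T}} :=
  [set component S x | x in ~: S].

Definition disconnected (S : {set T}) : Prop :=
  exists x y, [/\ x \notin S, y \notin S & ~~ connect (del_vertices S) x y].

Definition extra_vertex_cut (h : nat) (S : {set T}) : Prop :=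
  disconnected S /\ (forall C, C \in components S -> h < #|C|).

(* k is the minimum cardinality of an h-extra vertex-cut; in particular such
   a cut exists. *)
Definition is_extra_connectivity (h k : nat) : Prop :=
  (exists2 S, extra_vertex_cut h S & #|S| = k) /\
  (forall S, extra_vertex_cut h S -> k <= #|S|).

End ExtraConnectivity.

Definition lee_abs (a : 'I_3) : nat := minn a (3 - a).

(* The subtraction is that of the additive group Z/3Z on 'I_3. *)
Definition lee_dist (n : nat) (x y : {ffun 'I_n -> 'I_3}) : nat :=
  \sum_(i < n) lee_abs (x i - y i)%R.

Definition cube3 (n : nat) : rel {ffun 'I_n -> 'I_3} :=
  [rel x y | lee_dist x y == 1].
Arguments cube3 n : clear implicits.

Lemma cube3_sym n : symmetric (cube3 n).
Proof.
move=> x y; rewrite /cube3 /=; congr (_ == _); apply: eq_bigr => i _.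
by case: (x i) (y i) => [[|[|[|?]]] ?] [[|[|[|?]]] ?].
Qed.

Lemma cube3_irrefl n : irreflexive (cube3 n).
Proof.
move=> x; rewrite /cube3 /= /lee_dist big1 // => i _.
by rewrite GRing.subrr.
Qed.

(* Main.v *)
Require Import Defs.
From mathcomp Require Import all_boot all_order all_algebra.
From mathcomp Require Import zify.

Set Implicit Arguments.
Unset Strict Implicit.
Unset Printing Implicit Defensive.

(**
  Lower bound.  Call A and B separated if all Lee distances between them exceed
  1.  Cutting the (n+1)-cube along its first coordinate into three n-cubes, the
  layers A_c, B_c are separated, and for c <> d the projections of A_c and B_d
  are disjoint, so #|A_c| + #|B_d| <= 3 ^ n for all c, d.  From these
  inequalities alone, induction on n gives #|A| + #|B| + 2n <= 3 ^ n for
  nonempty separated sets and #|A| + #|B| + (4n - 3) <= 3 ^ n if moreover both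
  have at least two elements.  A 1-extra cut S separates a component A from
  the complement B of A :|: S.

  Upper bound.  The neighbourhood of the edge {00..0, 10..0} is a 1-extra cut
  of size 4n - 3.
*)

Local Notation cube n := {ffun 'I_n -> 'I_3}.

(** * Lee distance, coordinate by coordinate *)

Section LeeDistance.
Variable n : nat.
Implicit Types x y : cube n.

Lemma lee_abs_sub_eq0 (a b : 'I_3) : (lee_abs (a - b)%R == 0) = (a == b).
Proof. by case: a b => [[|[|[|?]]] ?] [[|[|[|?]]] ?]. Qed.

Lemma lee_abs_sub_neq (a b : 'I_3) : a != b -> lee_abs (a - b)%R = 1.
Proof. by case: a b => [[|[|[|?]]] ?] [[|[|[|?]]] ?]. Qed.

Lemma lee_dist_eq0 x y : (lee_dist x y == 0) = (x == y).
Proof.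
rewrite sum_nat_eq0; apply/forallP/eqP => [xy0|-> i].
  by apply/ffunP => i; apply/eqP; rewrite -lee_abs_sub_eq0; apply: xy0.
by rewrite lee_abs_sub_eq0 eqxx.
Qed.

Lemma lee_distxx x : lee_dist x x = 0.
Proof. by apply/eqP; rewrite lee_dist_eq0. Qed.

Lemma lee_distC x y : lee_dist x y = lee_dist y x.
Proof.
apply: eq_bigr => i _.
by case: (x i) (y i) => [[|[|[|?]]] ?] [[|[|[|?]]] ?].
Qed.

(** Modulo 3, negation moves exactly the nonzero coordinates, so [x] and [- x] differ precisely on
    the support of [x]. *)
Lemma lee_dist_oppr x : lee_dist x (- x)%R = lee_dist x 0%R.
Proof.
apply: eq_bigr => i _; rewrite !ffunE.
by case: (x i) => [[|[|[|?]]] ?].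
Qed.

Lemma lee_distN0 x : lee_dist (- x)%R 0%R = lee_dist x 0%R.
Proof.
apply: eq_bigr => i _; rewrite !ffunE.
by case: (x i) => [[|[|[|?]]] ?].
Qed.

End LeeDistance.

(** * Slicing the cube along its first coordinate *)

Section Layers.
Variable n : nat.

Definition fcons (c : 'I_3) (x : cube n) : cube n.+1 :=
  [ffun i => if unlift ord0 i is Some j then x j else c].

Definition ftail (z : cube n.+1) : cube n := [ffun i => z (lift ord0 i)].

Lemma fcons0 c x : fcons c x ord0 = c.
Proof. by rewrite ffunE unlift_none. Qed.

Lemma fconsK c x : ftail (fcons c x) = x.
Proof. by apply/ffunP => i; rewrite !ffunE liftK. Qed.

Lemma fcons_head_tail (z : cube n.+1) : fcons (z ord0) (ftail z) = z.
Proof.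
by apply/ffunP => i; rewrite ffunE; case: unliftP => [j|] ->; rewrite ?ffunE.
Qed.

Lemma lee_dist_head_tail (z w : cube n.+1) :
  lee_dist z w = lee_abs (z ord0 - w ord0)%R + lee_dist (ftail z) (ftail w).
Proof.
rewrite /lee_dist big_ord_recl; congr (_ + _).
by apply: eq_bigr => i _; rewrite !ffunE.
Qed.

Lemma lee_dist_fcons c d x y :
  lee_dist (fcons c x) (fcons d y) = lee_abs (c - d)%R + lee_dist x y.
Proof. by rewrite lee_dist_head_tail !fcons0 !fconsK. Qed.

Definition layer (A : {set cube n.+1}) (c : 'I_3) : {set cube n} :=
  [set x | fcons c x \in A].

Lemma card_layers (A : {set cube n.+1}) : #|A| = \sum_(c < 3) #|layer A c|.
Proof.
rewrite -sum1_card (partition_big (fun z : cube n.+1 => z ord0) xpredT) //=.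
apply: eq_bigr => c _; rewrite -sum1_card (reindex_onto (fcons c) ftail) /=.
  by apply: eq_bigl => x; rewrite fcons0 fconsK !eqxx inE !andbT.
by move=> z /andP[_ /eqP <-]; rewrite fcons_head_tail.
Qed.

End Layers.

Lemma card_cube n : #|{: cube n}| = 3 ^ n.
Proof. by rewrite card_ffun !card_ord. Qed.

(** * Cardinalities of separated sets *)

Definition separated n (A B : {set cube n}) :=
  forall x y, x \in A -> y \in B -> 1 < lee_dist x y.

Lemma separated_layer n (A B : {set cube n.+1}) c :
  separated A B -> separated (layer A c) (layer B c).
Proof.
move=> sAB x y; rewrite !inE => Ax By; have := sAB _ _ Ax By.
by rewrite lee_dist_fcons GRing.subrr.
Qed.

(** A tail common to both layers would give points of [A] and [B] differing at most in the first
    coordinate. *)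
Lemma card_layer_separated n (A B : {set cube n.+1}) c d :
  separated A B -> #|layer A c| + #|layer B d| <= 3 ^ n.
Proof.
move=> sAB; rewrite -card_cube -cardsUI.
suff -> : layer A c :&: layer B d = set0 by rewrite cards0 addn0 max_card.
apply/setP => x; rewrite !inE; apply/negP => /andP[Ax Bx].
have := sAB _ _ Ax Bx; rewrite lee_dist_fcons lee_distxx addn0.
have [->|/lee_abs_sub_neq -> //] := eqVneq c d.
by rewrite GRing.subrr.
Qed.

Lemma expn3_ge m : 4 * m.+2 < 3 ^ m.+2.
Proof. elim: m => // m; rewrite [3 ^ m.+3]expnS; lia. Qed.

(** Both bounds go through one induction, because a layer of a large set may be a single point. The
    [3] stands on the right to avoid truncated subtraction. *)
Definition separated_bounds (n a b : nat) : Prop :=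
  (0 < a -> 0 < b -> a + b + 2 * n <= 3 ^ n) /\
  (1 < a -> 1 < b -> a + b + 4 * n <= 3 ^ n + 3).

(** Summing [a c + b (s c) <= 3 ^ n] for a permutation [s] already bounds the total by [3 ^ n.+1].
    The remaining gap comes from [bounds] in layers meeting both sets and from [cross] elsewhere: if
    [b c = 0], then [a c] falls short of [3 ^ n] by at least every [b d]. *)
Lemma separated_layers_arith n (a b : 'I_3 -> nat) :
  (forall c d, a c + b d <= 3 ^ n) ->
  (forall c, separated_bounds n (a c) (b c)) ->
  separated_bounds n.+1 (\sum_(c < 3) a c) (\sum_(c < 3) b c).
Proof.
move=> cross bounds.
(* The power is opaque to [lia]. The inequality [4 * n < 3 ^ n] fails at [n = 1], so small values
   are given explicitly. *)
have pow3 : [\/ n = 0 /\ 3 ^ n = 1, n = 1 /\ 3 ^ n = 3 | 1 < n /\ 4 * n < 3 ^ n].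
  case: n {cross bounds} => [|[|n]]; [exact: Or31|exact: Or32|].
  by apply: Or33; split=> //; exact: expn3_ge.
have [i0 [i1 [i2 sum3]]] : exists i0 i1 i2,
    forall F : 'I_3 -> nat, \sum_(c < 3) F c = F i0 + F i1 + F i2.
  by do 3 eexists; move=> F; rewrite !big_ord_recr big_ord0.
rewrite /separated_bounds !sum3 expnS.
move: (bounds i0) (bounds i1) (bounds i2).
move: (cross i0 i0) (cross i0 i1) (cross i0 i2).
move: (cross i1 i0) (cross i1 i1) (cross i1 i2).
move: (cross i2 i0) (cross i2 i1) (cross i2 i2).
rewrite /separated_bounds.
move: (a i0) (a i1) (a i2) (b i0) (b i1) (b i2) (3 ^ n) pow3.
clear => ? ? ? ? ? ? ? pow3 *; case: pow3 => ?; split; lia.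
Qed.

Lemma card_separated n (A B : {set cube n}) : separated A B ->
  separated_bounds n #|A| #|B|.
Proof.
elim: n A B => [|m IH] A B sAB.
  (* The 0-cube has no two points at positive distance, so both bounds hold vacuously. *)
  have A0B0 : 0 < #|A| -> 0 < #|B| -> False.
    move=> /card_gt0P[x Ax] /card_gt0P[y By].
    by have := sAB x y Ax By; rewrite /lee_dist big_ord0.
  by split=> gtA gtB; case: A0B0; lia.
rewrite !card_layers; apply: separated_layers_arith => [c d|c].
  exact: card_layer_separated.
exact/IH/separated_layer.
Qed.

(** * Upper bound: the cut around an edge *)

Lemma card_sphere1 n : #|[set x : cube n | lee_dist x 0%R == 1]| = 2 * n.
Proof.
elim: n => [|n IH].
  by apply: eq_card0 => x; rewrite inE /lee_dist big_ord0.
set E := [set x | _].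
have inE_layer c x : (x \in layer E c) = (lee_abs c + lee_dist x 0%R == 1).
  rewrite !inE lee_dist_head_tail fcons0 fconsK !ffunE GRing.subr0.
  by congr (_ + lee_dist _ _ == _); apply/ffunP => i; rewrite !ffunE.
have layer0 : layer E ord0 = [set x | lee_dist x 0%R == 1].
  by apply/setP => x; rewrite inE_layer inE.
have layer_neq0 c : lee_abs c = 1 -> layer E c = [set (0%R : cube _)].
  move=> c1; apply/setP => x.
  by rewrite inE_layer in_set1 c1 add1n eqSS lee_dist_eq0.
rewrite card_layers !big_ord_recl big_ord0 layer0 IH !layer_neq0 // !cards1.
lia.
Qed.

Section EdgeCut.
Variable m : nat.
Local Notation height z := (lee_dist (ftail z) 0%R).

(* The neighbourhood of the edge {00..0, 10..0}: height 1 in the layers 0 and 1,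
   height 0 in layer 2 (the boolean is coerced to nat). *)
Definition edge_cut : {set cube m.+1} :=
  [set z : cube m.+1 | height z == (z ord0 != ord_max)].

Definition edge : {set cube m.+1} :=
  [set z : cube m.+1 | (z ord0 != ord_max) && (height z == 0)].

Lemma card_edge_cut : #|edge_cut| = 4 * m + 1.
Proof.
have in_layer c x :
    (x \in layer edge_cut c) = (lee_dist x 0%R == (c != ord_max)).
  by rewrite !inE fcons0 fconsK.
have layer_side c : c != ord_max ->
    layer edge_cut c = [set x | lee_dist x 0%R == 1].
  by move=> c2; apply/setP => x; rewrite in_layer inE c2.
have layer_max : layer edge_cut ord_max = [set (0%R : cube _)].
  by apply/setP => x; rewrite in_layer inE eqxx lee_dist_eq0.
rewrite card_layers !big_ord_recr big_ord0 /= layer_max cards1.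
rewrite !layer_side // card_sphere1; lia.
Qed.

Lemma edge_closed : closed (del_vertices (cube3 m.+1) edge_cut) (mem edge).
Proof.
have step z w : w \notin edge_cut -> lee_dist z w = 1 ->
    z \in edge -> w \in edge.
  rewrite !inE lee_dist_head_tail => wS zw /andP[z2 /[!lee_dist_eq0] /eqP z0].
  move: wS zw; rewrite z0 [lee_dist 0%R _]lee_distC -lee_dist_eq0.
  (* With the same head, [w] has height 1 in layer 0 or 1, hence is cut. With another head it has
     height 0, which is cut only in layer 2. *)
  have [<-|/lee_abs_sub_neq ->] := eqVneq (z ord0) (w ord0).
    by rewrite z2 GRing.subrr add0n => /[swap] ->.
  by rewrite add1n => + [w0]; rewrite w0; case: (w ord0 != ord_max).
move=> z w /and3P[zS wS /eqP zw]; apply/idP/idP; apply: step => //.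
by rewrite lee_distC.
Qed.

(** This rules out singleton components. A remaining point of height 1 must lie in layer 2, where
    negating its tail preserves the height. *)
Lemma edge_cut_neighbor (z : cube m.+1) : z \notin edge_cut ->
  exists2 w, w \notin edge_cut & lee_dist z w = 1.
Proof.
rewrite inE => zS; have [z1|z1] := eqVneq (height z) 1.
  exists (fcons (z ord0) (- ftail z)%R).
    by rewrite inE fcons0 fconsK lee_distN0.
  by rewrite lee_dist_head_tail fcons0 fconsK GRing.subrr lee_dist_oppr z1.
(* Layers 0 and 1 lose only points of height 1, so [c] can be either of them that differs from the
   head of [z]. *)
pose c : 'I_3 := if z ord0 == ord0 then 1%R else ord0.
exists (fcons c (ftail z)).
  rewrite inE fcons0 fconsK; suff -> : c != ord_max by [].
  by rewrite /c; case: ifP.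
rewrite lee_dist_head_tail fcons0 fconsK lee_distxx addn0 lee_abs_sub_neq //.
by rewrite /c; have [->|] := eqVneq (z ord0) ord0.
Qed.

End EdgeCut.

Lemma component_gt1 (T : finType) (e : rel T) (S : {set T}) x y :
  irreflexive e -> x \notin S -> y \notin S -> e x y ->
  1 < #|component e S x|.
Proof.
move=> eI xS yS exy; have neq_xy : x != y.
  by apply: contraTneq exy => ->; rewrite eI.
have -> : 2 = #|[set x; y]| by rewrite cards2 neq_xy.
apply/subset_leq_card/subsetP => z; rewrite !inE => /orP[]/eqP->.
  exact: connect0.
exact/connect1/and3P.
Qed.

Lemma edge_cut_extra m : extra_vertex_cut (cube3 m.+2) 1 (edge_cut m.+1).
Proof.
split.
  have height0 c : lee_dist (ftail (fcons c (0%R : cube m.+1))) 0%R = 0.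
    by rewrite fconsK lee_distxx.
  have height1 : lee_dist (fcons 1%R (0%R : cube m)) 0%R = 1.
    rewrite lee_dist_head_tail fcons0 fconsK.
    have -> : ftail 0%R = 0%R :> cube m by apply/ffunP => i; rewrite !ffunE.
    by rewrite lee_distxx ffunE.
  (* An end of the edge, and a point of height 1 in layer 2; the latter requires a second
     coordinate. *)
  exists (fcons ord0 0%R), (fcons ord_max (fcons 1%R 0%R)); split.
  - by rewrite inE height0 fcons0.
  - by rewrite inE fconsK height1 fcons0 eqxx.
  apply/negP => /(closed_connect (@edge_closed m.+1)) /=.
  by rewrite !inE height0 !fcons0 eqxx.
move=> _ /imsetP[z /[!inE] zS ->].
have [|w wS zw] := @edge_cut_neighbor m.+1 z; first by rewrite inE.
apply: component_gt1 wS _; rewrite ?inE //; first exact: cube3_irrefl.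
exact/eqP.
Qed.

(** * Lower bound for an arbitrary cut *)

Lemma component_disjoint (T : finType) (e : rel T) (S : {set T}) x :
  x \notin S -> [disjoint component e S x & S].
Proof.
move=> xS; rewrite disjoint_subset; apply/subsetP => y; rewrite !inE.
case/connectP=> p + ->; elim/last_ind: p => [//|p z _].
by rewrite rcons_path last_rcons => /andP[_ /and3P[]].
Qed.

Lemma extra_cut_lower_bound n (S : {set cube n}) :
  extra_vertex_cut (cube3 n) 1 S -> 4 * n - 3 <= #|S|.
Proof.
case=> [[x [y [xS yS not_xy]]] gt1].
set A := component (cube3 n) S x; pose B := ~: (A :|: S).
have dAS : [disjoint A & S] by apply: component_disjoint.
have sepAB : separated A B.
  move=> u v Au; rewrite !inE negb_or => /andP[Av vS].
  have uS : u \notin S by rewrite (disjointFr dAS).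
  have duv0 : lee_dist u v != 0.
    by rewrite lee_dist_eq0; apply: contraNneq Av => <-; rewrite inE in Au.
  have duv1 : lee_dist u v != 1.
    apply: contraNN Av => uv; rewrite inE in Au.
    by apply: connect_trans Au (connect1 _); apply/and3P.
  by case: lee_dist duv0 duv1 => [|[]].
have gt1A : 1 < #|A| by apply: gt1; apply: imset_f; rewrite inE.
(* [B] contains the whole component of [y]. *)
have gt1B : 1 < #|B|.
  apply: leq_trans (gt1 (component (cube3 n) S y) _) _.
    by apply: imset_f; rewrite inE.
  apply/subset_leq_card/subsetP => v vy.
  have vS : v \notin S by rewrite (disjointFr (component_disjoint _ yS) vy).
  rewrite !inE negb_or vS andbT; apply: contra not_xy => xv.
  have dsym : symmetric (del_vertices (cube3 n) S).
    by move=> a b; apply/and3P/and3P => -[? ? ?]; split; rewrite // cube3_sym.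
  by rewrite inE in vy; rewrite (connect_trans xv) // sym_connect_sym.
have cardV : #|A| + #|S| + #|B| = 3 ^ n.
  rewrite -card_cube -(cardsC (A :|: S)) -/B cardsU.
  by have /eqP -> : A :&: S == set0; rewrite ?setI_eq0 // cards0 subn0.
have [_ /(_ gt1A gt1B)] := card_separated sepAB.
move: cardV; move: #|A| #|B| #|S| => a b s; lia.
Qed.

Theorem theorem6 (n : nat) (hn : 2 <= n) :
  is_extra_connectivity (cube3 n) 1 (4 * n - 3).
Proof.
split; last by move=> S; apply: extra_cut_lower_bound.
case: n hn => [|[|m]] // _; exists (edge_cut m.+1).
  exact: edge_cut_extra.
(* The parameter of [edge_cut] is [n - 1], and [4 * (n - 1) + 1 = 4 * n - 3]. *)
rewrite card_edge_cut; lia.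
Qed.
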